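(* For every positive integer $d$ there exists a transitive digraph $D$ with $\dim(D) > d$.
   Context: All digraphs are finite and have simple underlying graphs (no loops, no multiple arcs, and at most one arc between any two vertices). For an integer $d\ge 0$ write $[d]=\{1,\dots,d\}$ (with $\mathbb{R}^0=\{0\}$). For $x=(x_1,\dots,x_d),y\in\mathbb{R}^d$ let $\mathcal{G}_{x>y}=\{i\in[d]: x_i>y_i\}$. The weak majority relation on $\mathbb{R}^d$ is defined by $x\succ y$ (equivalently $y\prec x$) iff $|\mathcal{G}_{x>y}|-|\mathcal{G}_{y>x}|>0$. A map $f:V(D)\to\mathbb{R}^d$ is an $\mathbb{R}^d$-realizer of a digraph $D$ if for all vertices $x,y$: $(x,y)\in A(D)$ iff $f(x)\succ f(y)$. The weak majority dimension $\dim(D)$ is the minimum nonnegative integer $d$ such that $D$ has an $\mathbb{R}^d$-realizer (such $d$ always exists). A digraph $D$ is transitive if $(x,z)\in A(D)$ whenever $(x,y)\in A(D)$ and $(y,z)\in A(D)$. *)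

(* Defs.v *)
From mathcomp Require Import all_boot all_order all_algebra.
From mathcomp Require Import boolp reals.

Set Implicit Arguments.
Unset Strict Implicit.
Unset Printing Implicit Defensive.

Import Order.TTheory GRing.Theory Num.Theory.
Local Open Scope ring_scope.

Record digraph := Digraph {
  vertex :> finType;
  adj : rel vertex;
  adj_irrefl : irreflexive adj;
  adj_oriented : forall x y, adj x y -> ~~ adj y x
}.

Definition gtset (R : realType) (d : nat) (x y : 'rV[R]_d) : {set 'I_d} :=
  [set i | x 0 i > y 0 i].

Definition weak_majority (R : realType) (d : nat) (x y : 'rV[R]_d) : bool :=
  (#|gtset x y|%:Z - #|gtset y x|%:Z > 0).

Definition realizer (R : realType) (d : nat) (D : digraph)
    (f : D -> 'rV[R]_d) : Prop :=
  forall x y : D, adj x y <-> weak_majority (f x) (f y).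

Definition realizable (R : realType) (D : digraph) (d : nat) : Prop :=
  exists f : D -> 'rV[R]_d, realizer f.

(** Two coordinates for each pair [p] of vertices: if [p = (a, b)] is an arc,
    they order the vertices as [a > b > others] and [others > a > b], which
    cancel out except on [(a, b)]; if [p] is not an arc, both are constant. *)
Definition arc_coord (D : digraph) (p : D * D) (c : bool) (x : D) : nat :=
  if adj p.1 p.2 then
    if x == p.1 then if c then 2 else 1
    else if x == p.2 then if c then 1 else 0
    else if c then 0 else 2
  else 0.

Lemma realizable_exists (R : realType) (D : digraph) :
  exists d, `[< realizable R D d >].
Proof.
pose I := (D * D * bool)%type.
exists #|{: I}|; apply/asboolP.
pose g x (u : I) := arc_coord u.1 u.2 x.
exists (fun x => \row_i (g x (enum_val i))%:R) => x y.
have cardE z t : #|gtset (\row_i (g z (enum_val i))%:R : 'rV[R]_#|{: I}|)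
                    (\row_i (g t (enum_val i))%:R)| =
    (\sum_(p : D * D) ((g t (p, true) < g z (p, true)) +
                       (g t (p, false) < g z (p, false))))%N.
  rewrite -sum1_card big_mkcond /=.
  rewrite (reindex_onto (@enum_rank I) (@enum_val I predT)) /=; last first.
    by move=> i _; rewrite enum_valK.
  rewrite (eq_bigl xpredT); last by move=> u; rewrite enum_rankK eqxx.
  transitivity (\sum_(u : I) (g t u < g z u : nat))%N.
    apply: eq_bigr => u _; rewrite inE !mxE enum_rankK ltr_nat.
    by case: ltnP.
  rewrite -(pair_big xpredT xpredT (fun p c => (g t (p, c) < g z (p, c) : nat)%N)).
  by apply: eq_bigr => p _; rewrite big_bool.
rewrite /weak_majority subr_gt0 ltz_nat !cardE.
have diffE z t : ~~ adj t z ->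
    (forall p : D * D,
      ((g z (p, true) < g t (p, true)) + (g z (p, false) < g t (p, false))
       + (2 * (adj z t && (p == (z, t)))) =
      (g t (p, true) < g z (p, true)) + (g t (p, false) < g z (p, false)))%N).
  move=> Ntz [a b]; rewrite /g /arc_coord /=.
  case: (boolP (adj a b)) => [ab | Nab]; last first.
    by case: eqP => [[<- <-] | _]; rewrite ?(negbTE Nab) ?andbF.
  have ba : b != a by apply: contraTneq ab => ->; rewrite adj_irrefl.
  have tazb : ~~ ((t == a) && (z == b)).
    by apply: contra Ntz => /andP[/eqP-> /eqP->].
  rewrite xpair_eqE ![_ == z]eq_sym ![_ == t]eq_sym.
  have zab : ~~ ((z == a) && (z == b)).
    by apply: contra ba => /andP[/eqP<- /eqP->].
  have tab : ~~ ((t == a) && (t == b)).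
    by apply: contra ba => /andP[/eqP<- /eqP->].
  have zt : (z == a) && (t == b) -> adj z t by case/andP=> /eqP-> /eqP->.
  move: tazb zab tab zt.
  by do 4!case: eqP => _ //=; case: (adj z t) => //= _ _ _ /(_ isT).
have sumD z t : ~~ adj t z ->
   (\sum_(p : D * D) ((g z (p, true) < g t (p, true)) +
                       (g z (p, false) < g t (p, false))) + 2 * adj z t =
   \sum_(p : D * D) ((g t (p, true) < g z (p, true)) +
                       (g t (p, false) < g z (p, false))))%N.
  move=> Ntz; have -> : (2 * adj z t =
      \sum_(p : D * D) 2 * (adj z t && (p == (z, t))))%N.
    rewrite (bigD1 (z, t)) //= eqxx andbT big1 ?addn0 // => p /negbTE ->.
    by rewrite andbF.
  by rewrite -big_split; apply: eq_bigr => p _; apply: diffE.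
case: (boolP (adj y x)) => [yx | Nyx].
  have Nxy := adj_oriented yx.
  rewrite (negbTE Nxy) -(sumD _ _ Nxy); split=> //.
  by rewrite ltnNge leq_addr.
rewrite -(sumD _ _ Nyx) -[X in (X < _)%N]addn0 ltn_add2l.
by case: (adj x y).
Qed.

Definition wm_dim (R : realType) (D : digraph) : nat :=
  ex_minn (realizable_exists R D).

(* Main.v *)
Require Import Defs.
From mathcomp Require Import all_boot all_order all_algebra.
From mathcomp Require Import boolp reals.
From mathcomp Require Import zify.

(** A counting argument. Whether a map is a realizer depends only on the order
    of the vertices in each coordinate, so at most (2n)^(2nd) labelled digraphs
    on 2n vertices are realizable in dimension d. On the other hand there are
    2^(n^2) ways of orienting a bipartite graph with parts of size n from the
    first part to the second, and all of these digraphs are transitive, having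
    no directed path of length two. For n large the second number is larger. *)

Set Implicit Arguments.
Unset Strict Implicit.
Unset Printing Implicit Defensive.

Import Order.TTheory GRing.Theory Num.Theory.
Local Open Scope ring_scope.

Lemma weak_majorityE (R : realType) (d : nat) (x y : 'rV[R]_d) :
  weak_majority x y = (#|gtset y x| < #|gtset x y|)%N.
Proof. by rewrite /weak_majority subr_gt0 ltz_nat. Qed.

Lemma card_gtset_row_mx (R : realType) (d k : nat) (x y : 'rV[R]_d) :
  #|gtset (row_mx x (0 : 'rV[R]_k)) (row_mx y 0)| = #|gtset x y|.
Proof.
rewrite -!sum1dep_card big_mkcond [RHS]big_mkcond big_split_ord /=.
rewrite [X in (_ + X)%N]big1 ?addn0; last first.
  by move=> i _; rewrite !row_mxEr !mxE ltxx.
by apply: eq_bigr => i _; rewrite !row_mxEl.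
Qed.

(** Padding with zero coordinates leaves both counts unchanged. Hence a digraph not realizable in
    dimension [d] has [wm_dim] above [d]. *)
Lemma realizable_leq (R : realType) (D : digraph) (d e : nat) :
  (d <= e)%N -> realizable R D d -> realizable R D e.
Proof.
move=> /subnKC <- [f fP]; exists (fun x => row_mx (f x) 0) => x y.
by rewrite weak_majorityE !card_gtset_row_mx -weak_majorityE; apply: fP.
Qed.

Section Rank.
Variables (disp : Order.disp_t) (O : orderType disp) (T : finType) (g : T -> O).

(** Ranks replace real values by numbers below [#|T|] with the same strict comparisons; tied values
    share a rank. *)
Definition rank (x : T) : nat := #|[set z | (g z < g x)%O]|.

Lemma rank_lt_card x : (rank x < #|T|)%N.
Proof.
rewrite -cardsT; apply: proper_card; apply/properP; split; first exact: subsetT.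
by exists x; rewrite ?inE ?ltxx.
Qed.

Lemma ltn_rank x y : (rank x < rank y)%N = (g x < g y)%O.
Proof.
case: ltP => [lt_xy | le_yx].
  apply: proper_card; apply/properP; split.
    by apply/subsetP => z; rewrite !inE => /lt_trans; apply.
  by exists x; rewrite inE ?ltxx.
apply/negbTE; rewrite -leqNgt; apply/subset_leq_card/subsetP => z.
by rewrite !inE => /lt_le_trans; apply.
Qed.

End Rank.

(** Weak majority read off a table of ranks. Such tables form a finite type, so they can be
    counted. *)
Definition rank_majority (d m : nat) (T : finType)
    (c : {ffun 'I_d * T -> 'I_m}) : rel T :=
  fun x y => (#|[set i | c (i, x) < c (i, y)]|
              < #|[set i | c (i, y) < c (i, x)]|)%N.

Lemma realizable_rank_majority (R : realType) (D : digraph) (d : nat) :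
  realizable R D d ->
  exists c : {ffun 'I_d * D -> 'I_#|D|}, @adj D =2 rank_majority c.
Proof.
move=> [f fP].
exists [ffun p => Ordinal (rank_lt_card (fun z => f z 0 p.1) p.2)] => x y.
have -> : adj x y = weak_majority (f x) (f y) by apply/idP/idP => /fP.
rewrite weak_majorityE /rank_majority; congr (_ < _)%N;
  by apply: eq_card => i; rewrite !inE !ffunE /= ltn_rank.
Qed.

Section Bipartite.
Variables (A B : finType) (S : {set A * B}).

Definition bip_adj : rel (A + B) := fun x y =>
  match x, y with inl a, inr b => (a, b) \in S | _, _ => false end.

Lemma bip_adj_irrefl : irreflexive bip_adj.
Proof. by case. Qed.

Lemma bip_adj_oriented x y : bip_adj x y -> ~~ bip_adj y x.
Proof. by case: x y => [a|b] []. Qed.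

Definition bip_digraph := Digraph bip_adj_irrefl bip_adj_oriented.

Lemma bip_digraph_trans : transitive (@adj bip_digraph).
Proof. by move=> [y|y] [x|x] [z|z]. Qed.

End Bipartite.

Lemma exists_unrealizable_bip (R : realType) (A B : finType) (d : nat) :
  (#|{: A + B}| ^ (d * #|{: A + B}|) < 2 ^ (#|A| * #|B|))%N ->
  exists S : {set A * B}, ~ realizable R (bip_digraph S) d.
Proof.
move=> lt_card.
pose decode (c : {ffun 'I_d * (A + B) -> 'I_#|{: A + B}|}) : {set A * B} :=
  [set p | rank_majority c (inl p.1) (inr p.2)].
(* Pigeonhole: there are fewer rank tables than subsets of [A * B], so some [S] is not decoded from
   any table. *)
have /subsetPn[S _ SN] : ~~ ([set: {set A * B}] \subset codom decode).
  apply: contraL lt_card => /subset_leq_card le_card.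
  rewrite -leqNgt -card_prod -cardsT -card_powerset.
  have -> : powerset [set: A * B] = [set: {set A * B}].
    by apply/setP => U; rewrite !inE subsetT.
  apply: leq_trans le_card _; apply: leq_trans (leq_image_card _ _) _.
  by rewrite card_ffun card_prod !card_ord.
exists S => /realizable_rank_majority[c cP]; case/negP: SN.
apply/codomP; exists c; apply/setP => -[a b].
by rewrite inE -(cP (inl a) (inr b)).
Qed.

Lemma bip_count (d : nat) (n := (2 ^ (8 * d))%N) :
  ((n + n) ^ (d * (n + n)) < 2 ^ (n * n))%N.
Proof.
have -> : (n + n = 2 ^ (8 * d).+1)%N by rewrite expnS mul2n addnn.
rewrite -expnM ltn_exp2l // expnS -/n.
(* Cancelling [n] from the exponents leaves [2 * d * (8 * d + 1) < n]. The left side is below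
   [(4 * d + 1) ^ 2], and [n] is the square of [2 ^ (4 * d)], which exceeds [4 * d]. *)
have lt_n : ((4 * d).+1 * (4 * d).+1 <= n)%N.
  have -> : (n = 2 ^ (4 * d) * 2 ^ (4 * d))%N by rewrite /n -expnD; congr expn; lia.
  by apply: leq_mul; apply: ltn_expl.
have n_gt0 : (0 < n)%N by rewrite expn_gt0.
by rewrite !mulnA ltn_pmul2r //; apply: leq_trans lt_n; lia.
Qed.

Theorem theorem2p7 (R : realType) (d : nat) (hd : (0 < d)%N) :
  exists D : digraph, transitive (@adj D) /\ (d < wm_dim R D)%N.
Proof.
pose n := (2 ^ (8 * d))%N.
have [|S SN] := @exists_unrealizable_bip R 'I_n 'I_n d.
  by rewrite card_sum !card_ord; apply: bip_count.
exists (bip_digraph S); split; first exact: bip_digraph_trans.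
rewrite /wm_dim; case: ex_minnP => m /asboolP mP _.
by rewrite ltnNge; apply: contra_notN SN => /realizable_leq; apply.
Qed.
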